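(* Let $X,Y\subseteq\mathsf{all}$ be such that $X\neq\emptyset$ and for all $x\in X$ there is $y\in Y$ with $y\ne x$. If $\mathsf{osc}\in X$ or $\mathsf{osc}\notin Y$, then $(\omega^\omega,\omega^\omega,\not\geq^* )\le_T(D_X,\mathrm{Sym}(\omega),R_Y)$.
   Context: Relational systems: a relational system is a triple $\mathcal A=(A_-,A_+,A)$ with $A\subseteq A_-\times A_+$ such that for every $a_-\in A_-$ there is $a_+\in A_+$ with $a_-\,A\,a_+$, and for every $a_+\in A_+$ there is $a_-\in A_-$ for which $a_-\,A\,a_+$ fails. $\mathcal A\le_T\mathcal B$ (Tukey reducibility), for $\mathcal B=(B_-,B_+,B)$, means that there are functions $\varphi_-:A_-\to B_-$ and $\varphi_+:B_+\to A_+$ such that for all $a_-\in A_-$, $b_+\in B_+$: $\varphi_-(a_-)\,B\,b_+$ implies $a_-\,A\,\varphi_+(b_+)$. Density: $n\in\omega$ is identified with $\{0,\dots,n-1\}$. For $A\subseteq\omega$, $\underline d(A)=\liminf_n|A\cap n|/n$ and $\overline d(A)=\limsup_n|A\cap n|/n$; if they are equal, $d(A)$ denotes the common value; if $\underline d(A)<\overline d(A)$, write $d(A)=\mathsf{osc}$, where $\mathsf{osc}$ is a formal symbol. $\mathsf{all}=[0,1]\cup\{\mathsf{osc}\}$. $\mathrm{Sym}(\omega)$ is the set of permutations of $\omega$. $D_X$ is the collection of infinite-coinfinite sets $A\subseteq\omega$ with $d(A)\in X$. For $A\in D_X$ and $\pi\in\mathrm{Sym}(\omega)$, $A\,R_Y\,\pi$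 means $d(\pi[A])\in Y$ and $d(\pi[A])\ne d(A)$. For $f,g\in\omega^\omega$, $f\le^*g$ (equivalently $g\ge^*f$) means $f(n)\le g(n)$ for all but finitely many $n$. In $(\omega^\omega,\omega^\omega,\not\geq^* )$, $g$ is related to $f$ iff $g\geq^* f$ fails. *)

(* Defs.v *)
From HB Require Import structures.
From mathcomp Require Import all_boot all_order all_algebra.
From mathcomp Require Import all_classical all_reals all_analysis.

Set Implicit Arguments.
Unset Strict Implicit.
Unset Printing Implicit Defensive.

Import Order.TTheory GRing.Theory Num.Theory.

Local Open Scope classical_set_scope.
Local Open Scope ring_scope.

Record rel_triple : Type := RelTriple {
  rt_minus : Type;
  rt_plus : Type;
  rt_rel : rt_minus -> rt_plus -> Prop }.

Definition relational_system (A : rel_triple) : Prop :=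
  (forall a : rt_minus A, exists b : rt_plus A, rt_rel a b) /\
  (forall b : rt_plus A, exists a : rt_minus A, ~ rt_rel a b).

(* Tukey reducibility is a relation between relational systems: a triple
   violating one of the two conditions above is not related to anything. *)
Definition tukey_le (A B : rel_triple) : Prop :=
  [/\ relational_system A, relational_system B &
    exists (phim : rt_minus A -> rt_minus B) (phip : rt_plus B -> rt_plus A),
      forall (a : rt_minus A) (b : rt_plus B),
        rt_rel (phim a) b -> rt_rel a (phip b)].

Definition le_star (f g : nat -> nat) : Prop :=
  \forall n \near \oo, (f n <= g n)%N.

Definition not_ge_star_system : rel_triple :=
  @RelTriple (nat -> nat) (nat -> nat) (fun g f => ~ le_star f g).

(* The term of index 0 is 0 / 0 = 0; it does not affect liminf and limsup. *)
Definition rel_freq (R : realType) (A : set nat) (n : nat) : R :=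
  #|[pred i : 'I_n | (i : nat) \in A]|%:R / n%:R.

(* [rel_freq R A] takes values in [0, 1], so the real-valued [limn_inf] and
   [limn_sup] are the genuine lower and upper limits. *)
Definition lower_density (R : realType) (A : set nat) : R :=
  limn_inf (rel_freq R A).

Definition upper_density (R : realType) (A : set nat) : R :=
  limn_sup (rel_freq R A).

Inductive dvalue (R : Type) : Type := dreal of R | osc.
Arguments osc {R}.

Definition all_dvalues (R : realType) : set (dvalue R) :=
  [set dreal r | r in [set r : R | 0 <= r <= 1]] `|` [set osc].
Arguments all_dvalues : clear implicits.

Definition density (R : realType) (A : set nat) : dvalue R :=
  if lower_density R A == upper_density R A then dreal (lower_density R A)
  else osc.

Definition Sym_omega : set (nat -> nat) := [set p | bijective p].

Definition D_set (R : realType) (X : set (dvalue R)) : set (set nat) :=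
  [set A | [/\ infinite_set A, infinite_set (~` A) & X (density R A)]].

Definition R_rel (R : realType) (Y : set (dvalue R))
    (A : set nat) (p : nat -> nat) : Prop :=
  Y (density R (p @` A)) /\ density R (p @` A) <> density R A.

Definition density_system (R : realType) (X Y : set (dvalue R)) : rel_triple :=
  @RelTriple (D_set X) Sym_omega (fun A p => R_rel Y (val A) (val p)).

(* Main.v *)
Require Import Defs.
From HB Require Import structures.
From mathcomp Require Import all_boot all_order all_algebra.
From mathcomp Require Import all_classical all_reals all_analysis.
From mathcomp Require Import zify lra.

(** The reduction sends a function [g] to a set [mix E g] glued from a fixed
    sequence [E] of sets: the naturals are cut into blocks whose lengths grow
    at least as fast as [g] prescribes, each block is a copy of some [E i], and
    every [i] is used in infinitely many blocks.

    Fix a permutation [p]. If a block starting at [a] is long compared with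
    how fast [p^-1] moves points, then some [m] much larger than [a] has all of
    its first [m] preimages before the end of the block, so up to time [m] the
    images under [p] of [mix E g] and of [E i] differ in at most [a + 1]
    points, a negligible number. Moreover [m] may be chosen so that the
    frequency of [p @` E i] at [m] nearly realizes its lower, or its upper,
    density. How long the blocks have to be is a function [f] of [p] alone, and
    [le_star f g] makes almost all blocks long enough. Hence, for all [i],
    [p @` mix E g] has lower density at most that of [p @` E i] and upper
    density at least that of [p @` E i] ([eventually_gaps_density]).

    If [osc] is in [X], let every [E i] be empty or the whole of the naturals,
    both occurring. Then [p @` mix E g] has lower density 0 and upper density
    1, so [p] does not change the value [osc] ([mix_osc]).

    If [osc] is in neither [X] nor [Y], take a real [x] in [X] and let [E i] be
    the shift by [i] of a Beatty set of slope [x]. Two facts carry the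
    argument. Inside any interval, each [E i] has as many points as density
    [x] predicts, up to an error of 1, so [mix E g] has density [x]
    ([mix_density]). And any natural number lies in [q * x] of the first [q]
    shifts, up to an error of 1; as this bound is pointwise it is not affected
    by [p], so at every time the frequencies of the images of the first [q]
    shifts average to [x], up to [1 / q]. Some [p @` E i] thus has lower density
    at most [x + e], some other has upper density at least [x - e], and
    [p @` mix E g] can only have density [x] or none ([mix_beatty]).

    In both cases the existence of permutations that do change the density of
    a given set comes from a bijection with a set of the wanted density, which
    is again of the form [mix E g]. *)

Set Implicit Arguments.
Unset Strict Implicit.
Unset Printing Implicit Defensive.

Import Order.TTheory GRing.Theory Num.Theory.
Import numFieldNormedType.Exports.

Local Open Scope classical_set_scope.
Local Open Scope ring_scope.

(** * Frequencies and densities *)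

Lemma rel_freqE (R : realType) (A : set nat) (n : nat) :
  rel_freq R A n = (\sum_(i < n) \1_A (i : nat)) / n%:R.
Proof.
rewrite /rel_freq -sum1_card natr_sum big_mkcond /=; congr (_ / _).
by apply: eq_bigr => i _; rewrite indicE inE; case: (_ \in A).
Qed.

Lemma rel_freq_itv (R : realType) (A : set nat) (n : nat) :
  0 <= rel_freq R A n <= 1.
Proof.
rewrite /rel_freq divr_ge0//=; have [->|n0] := posnP n.
  by rewrite invr0 mulr0 ler01.
by rewrite ler_pdivrMr ?ltr0n// mul1r ler_nat (leq_trans (max_card _))// card_ord.
Qed.

Lemma indic_setC (R : realType) (A : set nat) (n : nat) :
  \1_(~` A) n = 1 - \1_A n :> R.
Proof. by rewrite !indicE in_setC; case: (n \in A); rewrite /= ?subrr ?subr0. Qed.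

Lemma rel_freq_setC (R : realType) (A : set nat) (n : nat) :
  (0 < n)%N -> rel_freq R (~` A) n = 1 - rel_freq R A n.
Proof.
move=> n0; rewrite !rel_freqE; under eq_bigr do rewrite indic_setC.
by rewrite sumrB big_const_ord iter_addr addr0 mulrBl divff// pnatr_eq0 -lt0n.
Qed.

Lemma bounded_rel_freq (R : realType) (A : set nat) :
  bounded_fun (rel_freq R A : nat -> R^o).
Proof.
exists 1; split => // M M1 n _ /=; have /andP[u0 u1] := rel_freq_itv R A n.
by rewrite ger0_norm// (le_trans u1)// ltW.
Qed.

Lemma lower_densityE (R : realType) (A : set nat) :
  lower_density R A = sup (range (infs (rel_freq R A))).
Proof. exact: limn_infE (bounded_rel_freq R A). Qed.

Lemma upper_densityE (R : realType) (A : set nat) :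
  upper_density R A = inf (range (sups (rel_freq R A))).
Proof. exact: limn_supE (bounded_rel_freq R A). Qed.

Lemma lower_density_gt (R : realType) (A : set nat) (r : R) :
  r < lower_density R A ->
  exists N, forall n, (N <= n)%N -> r < rel_freq R A n.
Proof.
rewrite lower_densityE => /sup_gt[|_ [N _ <-] rN].
  by exists (infs (rel_freq R A) 0%N); exists 0%N.
exists N => n Nn; apply: (lt_le_trans rN); apply: ge_inf; last by exists n.
by exists 0 => _ [m _ <-]; have /andP[] := rel_freq_itv R A m.
Qed.

Lemma lower_density_ge (R : realType) (A : set nat) (r : R) (N : nat) :
  (forall n, (N <= n)%N -> r <= rel_freq R A n) -> r <= lower_density R A.
Proof.
move=> rA; rewrite lower_densityE.
apply: (@le_trans _ _ (infs (rel_freq R A) N)).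
  apply: lb_le_inf; first by exists (rel_freq R A N); exists N => /=.
  by move=> _ [n Nn <-]; exact: rA.
apply: ub_le_sup; last by exists N.
exact: bounded_fun_has_ubound_infs (bounded_rel_freq R A).
Qed.

(** Complementation turns lower bounds for upper densities into upper bounds for
    lower densities, so that the arguments below can be made for the latter. *)
Lemma upper_density_ge (R : realType) (A : set nat) :
  1 - lower_density R (~` A) <= upper_density R A.
Proof.
rewrite upper_densityE; apply: lb_le_inf.
  by exists (sups (rel_freq R A) 0%N); exists 0%N.
move=> _ [N _ <-]; rewrite lerBlDr -lerBlDl.
apply: (@lower_density_ge _ _ _ (maxn N 1)) => n.
rewrite geq_max => /andP[Nn n0]; rewrite rel_freq_setC// lerD2l lerN2.
apply: ub_le_sup; last by exists n.
by exists 1 => _ [m _ <-]; have /andP[] := rel_freq_itv R A m.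
Qed.

Lemma lower_density_le (R : realType) (A : set nat) (r : R) :
  (forall e, 0 < e -> forall N, exists2 n, (N <= n)%N & rel_freq R A n <= r + e) ->
  lower_density R A <= r.
Proof.
move=> rA; rewrite leNgt; apply/negP => /midf_lt[rm mA].
have [N Nm] := lower_density_gt mA.
have [|n Nn] := rA ((r + lower_density R A) / 2 - r) _ N; first by rewrite subr_gt0.
by rewrite subrKC leNgt Nm.
Qed.

Lemma lower_density_lt (R : realType) (A : set nat) (r : R) (N : nat) :
  lower_density R A < r -> exists2 n, (N <= n)%N & rel_freq R A n < r.
Proof.
move=> Ar; apply: contrapT => h; move: Ar; apply/negP; rewrite -leNgt.
apply: (@lower_density_ge _ _ _ N) => n Nn; rewrite leNgt; apply/negP => An.
by apply: h; exists n.
Qed.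

Lemma density_real (R : realType) (A : set nat) (x : R) :
  lower_density R A <= x -> x <= upper_density R A ->
  density R A <> osc -> density R A = dreal x.
Proof.
rewrite /density; case: ifP => // /eqP lu lx xu _.
by congr dreal; apply/le_anti; rewrite lx lu xu.
Qed.

Lemma density_osc (R : realType) (A : set nat) :
  lower_density R A < upper_density R A -> density R A = osc.
Proof. by rewrite /density => /lt_eqF ->. Qed.

Lemma density_cvg (R : realType) (A : set nat) (x : R) :
  rel_freq R A @ \oo --> x -> density R A = dreal x.
Proof.
by move=> /cvg_limn_inf_sup[l u]; rewrite /density /lower_density /upper_density l u eqxx.
Qed.

(** * Permutations of the naturals *)

Lemma image_bij (p q : nat -> nat) (A : set nat) :
  cancel p q -> cancel q p -> p @` A = q @^-1` A.
Proof.
move=> pK qK; apply/seteqP; split => [_ [n An <-]|n An] /=; first by rewrite pK.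
by exists (q n).
Qed.

Lemma image_bijC (p : nat -> nat) (A : set nat) :
  bijective p -> p @` (~` A) = ~` (p @` A).
Proof. by case=> q pK qK; rewrite !(image_bij _ pK qK) preimage_setC. Qed.

Lemma infinite_unbounded (A : set nat) :
  (forall N, exists2 n, (N <= n)%N & A n) -> infinite_set A.
Proof.
move=> Aoo /finite_seqP[B AB]; have [n nB An] := Aoo (\max_(i <- B) i).+1.
have : n \in B by move: An; rewrite AB.
by move=> /(@leq_bigmax_seq _ _ xpredT id); move=> /(_ isT); rewrite leqNgt nB.
Qed.

(** A bijection from [A] to [B] and one from the complement of [A] to that of [B]
    exist because all four sets are countably infinite; they are glued. *)
Lemma exists_bijection (A B : set nat) :
  infinite_set A -> infinite_set (~` A) -> infinite_set B -> infinite_set (~` B) ->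
  exists2 p : nat -> nat, bijective p & p @` A = B.
Proof.
move=> iA iA' iB iB'.
have card_eq (C D : set nat) : infinite_set C -> infinite_set D -> (C #= D)%card.
  by move=> iC iD; rewrite (card_eq_trans (eq_card_nat _ iC))// card_eq_sym eq_card_nat.
have [f [fAB finj fsurj]] := card_set_bijP (card_eq _ _ iA iB).
have [g [gAB ginj gsurj]] := card_set_bijP (card_eq _ _ iA' iB').
pose p n := if n \in A then f n else g n.
have pA n : A n -> p n = f n by move=> An; rewrite /p mem_set.
have pA' n : ~ A n -> p n = g n by move=> An; rewrite /p memNset.
exists p.
  rewrite -setTT_bijective; split => //.
    move=> m n _ _.
    have [/[dup] Am /pA ->|/[dup] Am /pA' ->] := pselect (A m).
      have [/[dup] An /pA ->|/[dup] An /pA' ->] := pselect (A n).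
        by apply: finj; rewrite inE.
      by move=> fg; case: (gAB _ An); rewrite -fg; apply: fAB.
    have [/[dup] An /pA ->|/[dup] An /pA' ->] := pselect (A n).
      by move=> fg; case: (gAB _ Am); rewrite fg; apply: fAB.
    by apply: ginj; rewrite inE.
  move=> n _; have [/fsurj[m Am <-]|/gsurj[m Am <-]] := pselect (B n).
    by exists m => //; rewrite pA.
  by exists m => //; rewrite pA'.
apply/seteqP; split => [_ [n An <-]|n /fsurj[m Am <-]].
  by rewrite pA//; exact: fAB.
by exists m => //; rewrite pA.
Qed.

(** * Sets agreeing on long intervals *)

Lemma card_inj_le (q : nat -> nat) (m a : nat) :
  injective q -> (#|[pred j : 'I_m | (q j <= a)%N]| <= a.+1)%N.
Proof.
move=> qinj; rewrite -[X in (_ <= X)%N]card_ord.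
rewrite -(@card_in_imset _ _ (fun j : 'I_m => inord (q j) : 'I_a.+1)) ?max_card//.
move=> i j; rewrite !inE => ia ja /(congr1 val); rewrite /= !inordK// => /qinj.
exact: val_inj.
Qed.

(** Of the first [m] points only those whose preimage is at most [a] can be
    in the image of [A] and not in that of [B], and there are at most [a + 1] of them. *)
Lemma rel_freq_image_le (R : realType) (p q : nat -> nat) (A B : set nat)
    (a b m : nat) :
  cancel p q -> cancel q p ->
  (forall n, (a < n < b)%N -> A n -> B n) -> (forall j, (j < m)%N -> (q j < b)%N) ->
  rel_freq R (p @` A) m <= rel_freq R (p @` B) m + a.+1%:R / m%:R.
Proof.
move=> pK qK AB qb; rewrite !rel_freqE !(image_bij _ pK qK) -mulrDl.
apply: ler_wpM2r; first by rewrite invr_ge0.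
apply: (@le_trans _ _ (\sum_(j < m) (\1_(q @^-1` B) (j : nat) + (q j <= a)%N%:R))).
  apply: ler_sum => j _; rewrite !indicE -natrD ler_nat.
  have [qa|qa] := leqP (q j) a; first by rewrite addn1 (leq_trans (leq_b1 _)).
  rewrite addn0; have [/set_mem Aqj|//] := boolP ((j : nat) \in q @^-1` A).
  by rewrite mem_set// /preimage /=; apply: AB => //; rewrite qa qb.
rewrite big_split /= lerD2l -natr_sum ler_nat.
apply: leq_trans (card_inj_le m a (can_inj qK)); rewrite -sum1_card [leqRHS]big_mkcond /=.
by apply: leq_sum => j _; rewrite inE; case: (q j <= a)%N.
Qed.

(** [f a] bounds the first [m] preimages, for some [m] that is at least
    [(a + 1) ^ 2] and at which [p @` B] is within [1 / (a + 1)] of its lower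
    density. On an interval from [a] to a point beyond [f a], passing from [B] to
    [A] raises this frequency by at most [(a + 1) / m <= 1 / (a + 1)]. An
    inclusion of [A] in [B] on the interval is enough, since only an upper bound
    for the frequency of [p @` A] is wanted. *)
Lemma long_gaps_lower_density (R : realType) (p : nat -> nat) (B : set nat) :
  bijective p ->
  exists f : nat -> nat, forall A : set nat,
    (forall N, exists a b, [/\ (N <= a)%N, (f a <= b)%N &
      forall n, (a < n < b)%N -> A n -> B n]) ->
    lower_density R (p @` A) <= lower_density R (p @` B).
Proof.
case=> q pK qK; set L := lower_density R (p @` B).
have /choice[f fP] a : exists b, exists m, [/\ (a.+1 ^ 2 <= m)%N,
    rel_freq R (p @` B) m < L + a.+1%:R^-1 & forall j, (j < m)%N -> (q j < b)%N].
  have [|m am Bm] := @lower_density_lt R (p @` B) (L + a.+1%:R^-1) (a.+1 ^ 2).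
    by rewrite ltrDl invr_gt0.
  exists (\max_(j < m) q j).+1, m; split => // j jm; rewrite ltnS.
  exact: (leq_bigmax (Ordinal jm)).
exists f => A AB; apply: lower_density_le => e e0 N.
(* The frequency of [p @` A] exceeds the lower density of [p @` B] by at most
   [2 / (a + 1)], hence the choice of [e / 2]. *)
have [k ke] := ltr_add_invr (divr_gt0 e0 (ltr0n R 2)).
have [a [b [Na fab ABab]]] := AB (maxn N k).
have [m [am Bm qf]] := fP a.
exists m; first by rewrite (leq_trans _ am)//; nia.
apply: (le_trans (rel_freq_image_le R pK qK ABab _)).
  by move=> j /qf /leq_trans; apply.
have a_small : a.+1%:R^-1 < e / 2 :> R.
  by apply: le_lt_trans ke; rewrite add0r lef_pV2 ?posrE ?ltr0n// ler_nat; lia.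
have : a.+1%:R / m%:R <= a.+1%:R^-1 :> R.
  have m0 : (0 < m)%N by apply: leq_trans am; rewrite expn_gt0.
  rewrite ler_pdivrMr ?ltr0n// mulrC ler_pdivlMr ?ltr0n// -natrM ler_nat.
  by rewrite mulnn.
by move: Bm a_small; move: (_ / m%:R) a.+1%:R^-1 => c d; lra.
Qed.

(** A single [f] serves the countably many sets [E i] and their complements,
    because it only has to dominate each of the individual bounds eventually. The
    complements give the bound for the upper density. *)
Lemma eventually_gaps_density (R : realType) (p : nat -> nat) (E : nat -> set nat) :
  bijective p ->
  exists f : nat -> nat, forall (A : set nat) (g : nat -> nat), le_star f g ->
    (forall i N, exists a b, [/\ (N <= a)%N, (g a <= b)%N &
      forall n, (a < n < b)%N -> (A n <-> E i n)]) ->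
    forall i, lower_density R (p @` A) <= lower_density R (p @` E i) /\
      1 - lower_density R (p @` (~` E i)) <= upper_density R (p @` A).
Proof.
move=> pbij.
have /choice[f fP] i := long_gaps_lower_density R (E i) pbij.
have /choice[f' f'P] i := long_gaps_lower_density R (~` E i) pbij.
exists (fun n => \max_(i < n) maxn (f i n) (f' i n)) => A g [M _ fg] AE i.
have gap N : exists a b, [/\ (N <= a)%N, (maxn (f i a) (f' i a) <= b)%N &
    forall n, (a < n < b)%N -> (A n <-> E i n)].
  have [a [b [aN gb AEab]]] := AE i (maxn N (maxn M i.+1)).
  move: aN; rewrite !geq_max => /and3P[Na Ma ia].
  exists a, b; split => //; apply: leq_trans gb; apply: leq_trans (fg _ Ma).
  exact: (leq_bigmax (Ordinal ia)).
split.
  apply: fP => N; have [a [b [Na]]] := gap N; rewrite geq_max => /andP[fab _] AEab.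
  by exists a, b; split => // n nab /(AEab n nab).
apply: le_trans (upper_density_ge _ _); rewrite lerD2l lerN2 -image_bijC//.
apply: f'P => N; have [a [b [Na]]] := gap N; rewrite geq_max => /andP[_ fab] AEab.
by exists a, b; split => // n nab An /(AEab n nab).
Qed.

(** * Gluing a sequence of sets along fast growing blocks *)

(** The summand [2 j + 1] makes [node g k] at least [k ^ 2], so that the number
    of blocks begun before [m] is negligible compared with [m]. *)
Fixpoint node (g : nat -> nat) (k : nat) : nat :=
  if k is j.+1 then (node g j + j.*2.+1 + g (node g j))%N else 0%N.

(** The 2-adic valuation of [k + 1] takes every value for infinitely many [k].
    The first points of the blocks are put alternately in and out of the set, so
    that [mix E g] is infinite and coinfinite whatever [E] is, even if all [E i]
    are empty. *)
Definition mix (E : nat -> set nat) (g : nat -> nat) : set nat :=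
  [set n | exists k, (n = node g k /\ odd k) \/
    ((node g k < n < node g k.+1)%N /\ E (logn 2 k.+1) n)].

Section node.
Local Open Scope nat_scope.

Lemma node_lt g k : node g k < node g k.+1. Proof. by rewrite /=; lia. Qed.

Lemma node_mono g : {mono node g : j k / j < k}.
Proof. exact/leqW_mono/leq_mono/(homo_ltn ltn_trans)/node_lt. Qed.

Lemma node_sq g k : k ^ 2 <= node g k.
Proof. by elim: k => //= k; rewrite -!mulnn; lia. Qed.

Lemma node_ge g k : k <= node g k.
Proof. by apply: leq_trans (node_sq g k); rewrite -mulnn; case: k => // k; rewrite leq_pmulr. Qed.

Lemma node_block g j k n :
  node g j <= n < node g j.+1 -> node g k <= n < node g k.+1 -> j = k.
Proof.
move=> /andP[jn nj] /andP[kn nk].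
have : j < k.+1 by rewrite -(node_mono g) (leq_ltn_trans jn).
have : k < j.+1 by rewrite -(node_mono g) (leq_ltn_trans kn).
lia.
Qed.

Lemma node_exists g n : exists k, node g k <= n < node g k.+1.
Proof.
have ex0 : exists k, node g k <= n by exists 0.
have ub k : node g k <= n -> k <= n := leq_trans (node_ge g k).
case: (ex_maxnP ex0 ub) => k kn kmax.
exists k; rewrite kn /= ltnNge; apply/negP => /(kmax k.+1).
by rewrite ltnn.
Qed.

Lemma mix_node E g k : mix E g (node g k) <-> odd k.
Proof.
split=> [[j [[/eqP kj oj]|[jk _]]]|ok]; last by exists k; left.
  by rewrite (@node_block g k j (node g k)) ?leqnn ?node_lt// (eqP kj) leqnn node_lt.
have/andP[jk' _] := jk.
have jkE : j = k.
  by apply: (@node_block g _ _ (node g k)); rewrite ?leqnn ?node_lt// ltnW//; case/andP: jk.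
by move: jk'; rewrite jkE ltnn.
Qed.

Lemma mix_block E g k n :
  node g k < n < node g k.+1 -> (mix E g n <-> E (logn 2 k.+1) n).
Proof.
move=> nk; split=> [[j [[nj _]|[jn En]]]|En]; last by exists k; right.
  move: nk; rewrite nj; rewrite !node_mono; lia.
rewrite (@node_block g k j n)//.
by case/andP: nk => /ltnW -> ->.
by case/andP: jn => /ltnW -> ->.
Qed.

(** The blocks with index [2 ^ i * (2 N + 1) - 1] are copies of [E i] and
    can be taken as far out as needed. *)
Lemma mix_gaps E g i N : exists a b, [/\ N <= a, g a <= b &
  forall n, a < n < b -> (mix E g n <-> E i n)].
Proof.
pose k := (2 ^ i * N.*2.+1).-1.
have kE : k.+1 = 2 ^ i * N.*2.+1 by rewrite prednK// muln_gt0 expn_gt0.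
have Nk : N <= k.
  by rewrite -ltnS kE; apply: (@leq_trans N.*2.+1); [lia|rewrite leq_pmull ?expn_gt0].
exists (node g k), (node g k.+1); split.
- exact: leq_trans (node_ge g k).
- by rewrite /= leq_addl.
move=> n nk; apply: (iff_trans (mix_block E nk)); rewrite kE lognM ?expn_gt0// pfactorK//.
by rewrite lognE dvdn2 /= odd_double /= addn0.
Qed.
End node.

Lemma mix_infinite E g : infinite_set (mix E g).
Proof.
apply: infinite_unbounded => N; exists (node g N.*2.+1); last first.
  by apply/mix_node; rewrite /= odd_double.
by apply: leq_trans (node_ge g _); lia.
Qed.

Lemma mix_coinfinite E g : infinite_set (~` mix E g).
Proof.
apply: infinite_unbounded => N; exists (node g N.*2); last first.
  by move/mix_node; rewrite odd_double.
by apply: leq_trans (node_ge g _); lia.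
Qed.

(** * Averaging over a sequence of sets *)

(** Were the lower densities all larger than [x + e], then at some time [m] the
    first [q] frequencies would all exceed [x + e], whereas their sum, computed
    point by point, is at most [q * x + 1]: a contradiction once [1 / q < e]. *)
Lemma lower_density_average (R : realType) (E : nat -> set nat) (x : R)
    (p : nat -> nat) :
  (forall q n, \sum_(i < q) \1_(E i) n <= q%:R * x + 1) -> bijective p ->
  forall e, 0 < e -> exists i, lower_density R (p @` E i) <= x + e.
Proof.
move=> Ex [p' pK p'K] e e0; have [k ke] := ltr_add_invr e0.
rewrite add0r in ke; apply: contrapT => noi.
have /choice[N NP] (i : nat) :
    exists N, forall m, (N <= m)%N -> x + e < rel_freq R (p @` E i) m.
  by apply: lower_density_gt; rewrite ltNge; apply/negP => ?; apply: noi; exists i.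
pose q := k.+1; pose m := (\max_(i < q) N i).+1.
have m0 : 0 < m%:R :> R by rewrite ltr0n.
have : \sum_(i < q) (x + e) <= \sum_(i < q) rel_freq R (p @` E i) m.
  by apply: ler_sum => i _; apply/ltW/NP/leqW/leq_bigmax.
under [leRHS]eq_bigr do rewrite rel_freqE.
rewrite -mulr_suml exchange_big /= ler_pdivlMr// sumr_const card_ord.
apply/negP; rewrite -ltNge.
apply: (@le_lt_trans _ _ (\sum_(j < m) (q%:R * x + 1))).
  apply: ler_sum => j _; under eq_bigr do rewrite (image_bij _ pK p'K).
  exact: Ex.
rewrite sumr_const card_ord -[_ *+ m]mulr_natr ltr_pM2r// -[(x + e) *+ q]mulr_natl mulrDr ltrD2l.
by move: ke; rewrite -ltr_pdivrMl ?ltr0n// mulr1.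
Qed.

(** * Beatty sets and their shifts *)

(** The jumps of [n |-> floor (n * x)]. For [x] between 0 and 1 the set has [floor (n * x)] elements below
    [n], and an interval of length [l] contains [l * x] of them up to an error of
    1, wherever it lies. *)
Definition beatty (R : realType) (x : R) : set nat :=
  [set n | Num.floor (n.+1%:R * x) = Num.floor (n%:R * x) + 1].

Lemma indic_beatty (R : realType) (x : R) (n : nat) : 0 <= x <= 1 ->
  \1_(beatty x) n = (Num.floor (n.+1%:R * x))%:~R - (Num.floor (n%:R * x))%:~R :> R.
Proof.
move=> /andP[x0 x1]; rewrite -intrB indicE.
have nx : n.+1%:R * x = n%:R * x + x by rewrite -natr1 mulrDl mul1r.
have [lo|] := lerP (Num.floor (n.+1%:R * x)) (Num.floor (n%:R * x)).
  rewrite memNset; last by rewrite /beatty /= => fE; move: lo; rewrite fE gerDl.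
  have -> : Num.floor (n.+1%:R * x) = Num.floor (n%:R * x).
    by apply/le_anti; rewrite lo le_floor// nx lerDl.
  by rewrite subrr.
rewrite -lezD1 => hi.
have fE : Num.floor (n.+1%:R * x) = Num.floor (n%:R * x) + 1.
  apply/le_anti; rewrite hi andbT -ltzD1 floor_lt_int nx.
  by have := floorD1_gt (n%:R * x); rewrite !intrD; lra.
by rewrite mem_set// fE addrC addKr.
Qed.

Lemma beatty_discrepancy (R : realType) (x : R) (a b : nat) : 0 <= x <= 1 ->
  (a <= b)%N -> `|\sum_(a <= n < b) \1_(beatty x) n - (b%:R - a%:R) * x| <= 1.
Proof.
move=> x01 ab; under eq_bigr do rewrite indic_beatty//.
rewrite (telescope_sumr (fun n => (Num.floor (n%:R * x))%:~R : R))// mulrBl.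
move: (b%:R * x) (a%:R * x) => u v.
have := floor_le u; have := floor_le v.
have := floorD1_gt u; have := floorD1_gt v; rewrite !intrD ler_norml.
move: (Num.floor u)%:~R (Num.floor v)%:~R => fu fv; lra.
Qed.

Definition beatty_shift (R : realType) (x : R) (i : nat) : set nat :=
  [set n | beatty x (n + i)%N].

Lemma beatty_shift_discrepancy (R : realType) (x : R) (i a b : nat) :
  0 <= x <= 1 -> (a <= b)%N ->
  `|\sum_(a <= n < b) \1_(beatty_shift x i) n - (b%:R - a%:R) * x| <= 1.
Proof.
move=> x01 ab; have abi : (a + i <= b + i)%N by rewrite leq_add2r.
have := beatty_discrepancy x01 abi.
by rewrite big_addn addnK !natrD opprD addrACA subrr addr0.
Qed.

(** The shift by [i] contains [n] exactly when the Beatty set contains [n + i], so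
    this is the discrepancy of the Beatty set on an interval of length [q]. *)
Lemma beatty_shift_average (R : realType) (x : R) (q n : nat) : 0 <= x <= 1 ->
  `|\sum_(i < q) \1_(beatty_shift x i) n - q%:R * x| <= 1.
Proof.
move=> x01; have := beatty_discrepancy x01 (leq_addl q n).
rewrite -{1}[n]add0n big_addn addnK big_mkord natrD addrK.
by under eq_bigr => i _ do rewrite addnC.
Qed.

(** Each block contributes an error of at most 1 for the copied piece of
    [E i], and at most 1 for its first point. *)
Lemma mix_discrepancy (R : realType) (E : nat -> set nat) (g : nat -> nat) (x : R)
    (k m : nat) : 0 <= x <= 1 ->
  (forall i a b, (a <= b)%N ->
    `|\sum_(a <= n < b) \1_(E i) n - (b%:R - a%:R) * x| <= 1) ->
  (node g k <= m <= node g k.+1)%N ->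
  `|\sum_(0 <= n < m) \1_(mix E g) n - m%:R * x| <= k.+1.*2%:R.
Proof.
move=> x01 Ex.
have step j l : (node g j < l <= node g j.+1)%N ->
    `|\sum_(0 <= n < l) \1_(mix E g) n - l%:R * x| <=
    `|\sum_(0 <= n < node g j) \1_(mix E g) n - (node g j)%:R * x| + 2.
  move=> /andP[jl lj].
  rewrite (@big_cat_nat _ _ _ (node g j) _ l _ _ (leq0n _) (ltnW jl)) /=.
  rewrite [\sum_(node g j <= n < l) _]big_ltn//.
  have -> : \sum_((node g j).+1 <= n < l) \1_(mix E g) n =
      \sum_((node g j).+1 <= n < l) \1_(E (logn 2 j.+1)) n :> R.
    apply: eq_big_nat => n /andP[jn nl]; rewrite !indicE; congr (_%:R : R).
    by congr nat_of_bool; apply/idP/idP; rewrite !inE => ?;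
      apply/(@mix_block E g j n) => //; rewrite jn (leq_trans nl).
  have := Ex (logn 2 j.+1) _ _ jl.
  have : 0 <= (\1_(mix E g) (node g j) : R) <= 1.
    by rewrite indicE ler0n lern1 leq_b1.
  rewrite -natr1 /=.
  move: (\sum_(_ <= n < l) _) (\sum_(_ <= n < node g j) _) => u v.
  move: (\1_(mix E g) (node g j)) (l%:R : R) ((node g j)%:R : R) => w L J w01 uw.
  have -> : v + (w + u) - L * x = (v - J * x) + ((w - x) + (u - (L - (J + 1)) * x)) by lra.
  apply: le_trans (ler_normD _ _) _; rewrite lerD2l.
  apply: le_trans (ler_normD _ _) _; rewrite (_ : 2 = 1 + 1)//; apply: lerD => //.
  by rewrite ler_norml; move: x01 w01; lra.
have node_bound j : `|\sum_(0 <= n < node g j) \1_(mix E g) n - (node g j)%:R * x| <= j.*2%:R.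
  elim: j => [|j IH]; first by rewrite big_geq// mul0r subr0 normr0.
  apply: le_trans (step j _ _) _; first by rewrite node_lt leqnn.
  by rewrite doubleS -[j.*2.+2]addn2 natrD lerD2r.
move=> /andP[]; rewrite leq_eqVlt => /predU1P[<- _|km mk].
  by apply: le_trans (node_bound k) _; rewrite ler_nat leq_double.
apply: le_trans (step k _ _) _; first by rewrite km.
by rewrite doubleS -[k.*2.+2]addn2 natrD lerD2r.
Qed.

(** If [m] lies in block [k] then the error is at most [2 (k + 1)] while
    [k ^ 2 <= m], so the error is of the order of the square root of [m]. *)
Lemma mix_density (R : realType) (E : nat -> set nat) (g : nat -> nat) (x : R) :
  0 <= x <= 1 ->
  (forall i a b, (a <= b)%N ->
    `|\sum_(a <= n < b) \1_(E i) n - (b%:R - a%:R) * x| <= 1) ->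
  density R (mix E g) = dreal x.
Proof.
move=> x01 Ex; apply: density_cvg; apply/cvgrPdist_le => e e0.
have e4 : 0 < e / 4 by rewrite divr_gt0.
(* The error is at most [2 (k + 1) <= 4 sqrt m], which is at most [e * m] once
   [sqrt m >= 4 / e]. *)
pose K := (Num.truncn (e / 4)^-1).+1.
exists (K ^ 2)%N => // m /= Km.
have m0 : (0 < m)%N by apply: leq_trans Km; rewrite expn_gt0.
have [k /andP[km mk]] := node_exists g m.
have k_m : (k.+1 ^ 2 <= 4 * m)%N by have := leq_trans (node_sq g k) km; case: k {km mk} => [|k]; nia.
have := mix_discrepancy x01 Ex (introT andP (conj km (ltnW mk))).
rewrite big_mkord => D; rewrite distrC rel_freqE.
have -> : (\sum_(i < m) \1_(mix E g) (i : nat)) / m%:R - x =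
    (\sum_(i < m) \1_(mix E g) (i : nat) - m%:R * x) / m%:R.
  by rewrite mulrBl mulrC mulrAC divff ?mul1r 1?mulrC// pnatr_eq0 -lt0n.
rewrite normrM normfV [`|m%:R|]ger0_norm// ler_pdivrMr ?ltr0n//.
apply: (le_trans D).
have Ke : K%:R^-1 <= e / 4.
  by rewrite -[leRHS]invrK lef_pV2 ?posrE ?invr_gt0 ?ltr0n// ltW// truncnS_gt.
have kmK : (k.+1 * K <= 2 * m)%N.
  rewrite -(@leq_exp2r _ _ 2)// !expnMn; nia.
have : (k.+1.*2 * K)%:R <= (4 * m)%:R :> R by rewrite ler_nat; lia.
rewrite !natrM -ler_pdivlMr ?ltr0n// => /le_trans; apply.
apply: (@le_trans _ _ (4 * m%:R * (e / 4))); last by lra.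
by rewrite ler_wpM2l// mulr_ge0.
Qed.

(** * The two families of sets *)

Lemma lower_density_set0 (R : realType) : lower_density R set0 <= 0.
Proof.
apply: lower_density_le => e e0 N; exists N => //.
by rewrite rel_freqE big1 ?mul0r ?add0r ?ltW// => i _; rewrite indicE in_set0.
Qed.

Definition all_or_nothing (i : nat) : set nat := if i is 0 then set0 else setT.

Lemma mix_osc (R : realType) (p : nat -> nat) : bijective p ->
  exists f, forall g, le_star f g ->
    density R (p @` mix all_or_nothing g) = osc.
Proof.
move=> /(eventually_gaps_density R all_or_nothing)[f fP].
exists f => g /fP/(_ (mix_gaps all_or_nothing g)) pg; apply: density_osc.
have [low _] := pg 0%N; have [_ up] := pg 1%N.
apply: le_lt_trans low _; apply: lt_le_trans up; rewrite /= setCT image_set0.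
by have := lower_density_set0 R; lra.
Qed.

(** The case of the identity shows that [mix all_or_nothing g] itself has no
    density as soon as [g] grows fast enough. *)
Lemma mix_osc_id (R : realType) :
  exists f, forall g, le_star f g -> density R (mix all_or_nothing g) = osc.
Proof.
have idbij : bijective (@id nat) by exists id.
have [f fP] := mix_osc R idbij; exists f => g /fP; by rewrite image_id.
Qed.

Lemma mix_beatty (R : realType) (x : R) (p : nat -> nat) : 0 <= x <= 1 ->
  bijective p ->
  exists f, forall g, le_star f g ->
    density R (p @` mix (beatty_shift x) g) <> osc ->
    density R (p @` mix (beatty_shift x) g) = dreal x.
Proof.
move=> x01 pbij; have [f fP] := eventually_gaps_density R (beatty_shift x) pbij.
exists f => g /fP/(_ (mix_gaps (beatty_shift x) g)) pg; apply: density_real.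
  apply/ler_addgt0Pr => e e0.
  have [|i] := @lower_density_average R (beatty_shift x) x p _ pbij e e0.
    by move=> q n; have := beatty_shift_average q n x01; rewrite ler_distlC; lra.
  by have [low _] := pg i; exact: le_trans.
apply/ler_addgt0Pl => e e0; rewrite -lerBlDl.
have [|i pi] := @lower_density_average R (fun i => ~` beatty_shift x i) (1 - x) p _ pbij e e0.
  move=> q n; under eq_bigr do rewrite indic_setC.
  rewrite sumrB sumr_const card_ord.
  by have := beatty_shift_average q n x01; rewrite ler_distlC; lra.
have [_ up] := pg i; apply: le_trans up.
by move: pi; lra.
Qed.

Lemma density_realized (R : realType) (y : dvalue R) : all_dvalues R y ->
  exists B, [/\ infinite_set B, infinite_set (~` B) & density R B = y].
Proof.
case=> [[x /= x01 <-]|->].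
  exists (mix (beatty_shift x) id); split; [exact: mix_infinite|exact: mix_coinfinite|].
  by apply: mix_density => // i a b; exact: beatty_shift_discrepancy.
have [f fP] := mix_osc_id R.
exists (mix all_or_nothing f); split; [exact: mix_infinite|exact: mix_coinfinite|].
by apply: fP; exists 0%N.
Qed.

(** * The reduction *)

(** That no permutation is related to all sets of [D_set X] comes from the
    reduction itself: [p] is not related to [A g] when [g] is the function [f]
    attached to [p]. Every set is related to some permutation because [Y]
    has an element other than its density, and that element is realized. *)
Lemma tukey_le_density (R : realType) (X Y : set (dvalue R))
    (A : (nat -> nat) -> set nat) :
  Y `<=` all_dvalues R ->
  (forall x, X x -> exists y, Y y /\ y <> x) ->
  (forall g, D_set X (A g)) ->
  (forall p, bijective p -> exists f, forall g, le_star f g -> ~ R_rel Y (A g) p) ->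
  tukey_le not_ge_star_system (density_system X Y).
Proof.
move=> Y_all XY AX AY.
pose phim g : D_set X := SigSub (mem_set (AX g)).
have /choice[phip phipP] (p : Sym_omega) :
    exists f, forall g, le_star f g -> ~ R_rel Y (A g) (val p).
  exact/AY/set_mem/valP.
split.
- split=> [g|f]; last by exists f; apply; exists 0%N.
  exists (fun n => (g n).+1) => -[N _ /(_ N (leqnn N))]; by rewrite ltnn.
- split=> [B|p]; last by exists (phim (phip p)); apply: phipP; exists 0%N.
  have [iB iB' /XY[y [Yy yB]]] := set_mem (valP B).
  have [C [iC iC' dC]] := density_realized (Y_all _ Yy).
  have [p pbij pB] := exists_bijection iB iB' iC iC'.
  exists (SigSub (mem_set (pbij : Sym_omega p))) => /=.
  by rewrite /R_rel /= pB dC.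
exists phim, phip => g p gp /phipP; exact.
Qed.

Theorem theorem20 (R : realType) (X Y : set (dvalue R))
  (X_all : X `<=` all_dvalues R) (Y_all : Y `<=` all_dvalues R)
  (X_neq0 : X !=set0)
  (XY : forall x : dvalue R, X x -> exists y : dvalue R, Y y /\ y <> x)
  (Xosc_or_Yosc : X osc \/ ~ Y osc) :
  tukey_le not_ge_star_system (density_system X Y).
Proof.
have [Xosc|nXosc] := pselect (X osc).
  have [f0 f0P] := mix_osc_id R.
  (* Taking the maximum with [f0] forces [A g] into [D_set X] for slow [g]. *)
  pose A g := mix all_or_nothing (fun n => maxn (f0 n) (g n)).
  have dA g : density R (A g) = osc.
    by apply: f0P; exists 0%N => // n _; exact: leq_maxl.
  apply: (@tukey_le_density _ _ _ A) => // [g|p /(mix_osc R)[f fP]].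
    by split; [exact: mix_infinite|exact: mix_coinfinite|rewrite dA].
  exists f => g [N _ fg] [_]; rewrite dA; apply; apply: fP.
  by exists N => // n /fg /= fgn; rewrite (leq_trans fgn)// leq_maxr.
have [x Xx] := X_neq0; have nYosc : ~ Y osc by case: Xosc_or_Yosc.
have [[r /= r01 rx]|xosc] := X_all _ Xx; last by rewrite xosc in Xx.
have dA g : density R (mix (beatty_shift r) g) = dreal r.
  by apply: mix_density => // i a b; exact: beatty_shift_discrepancy.
apply: (@tukey_le_density _ _ _ (mix (beatty_shift r))) => // [g|p].
  by split; [exact: mix_infinite|exact: mix_coinfinite|rewrite dA rx].
move=> /(mix_beatty r01)[f fP]; exists f => g /fP pg [Yp].
by rewrite dA; apply; apply: pg => posc; apply: nYosc; rewrite -posc.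
Qed.
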